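(* Let $\mathcal{Q}$ be the set of odd primes $p$ for which there exist $j\in\{1,4,8\}$ and integers $x,y$ with $\gcd(x,y)=1$ and $8x^2+27y^2=jp$. For every $p\in\mathcal{Q}$ and every integer $n\geq 0$, \[ b_{21}\bigl(4(p^2n+\beta p-11\cdot 24^{-1}_p)+1\bigr)\equiv 0 \pmod{2} \] for all integers $\beta$ with $0\leq \beta<p$ and $\beta\neq \dfrac{11(p^2+24\cdot 24^{-1}_p-1)}{24p}$.
   Context: For an integer $t\geq 2$, $b_t(n)$ denotes the number of $t$-regular partitions of $n$, i.e. partitions of $n$ none of whose parts is divisible by $t$ (with $b_t(0)=1$); equivalently $\sum_{n\geq 0}b_t(n)q^n=\prod_{k\geq1}\frac{1-q^{tk}}{1-q^k}$. For a prime $p\geq 5$, $24^{-1}_p$ denotes the integer congruent to the inverse of $24$ modulo $p$ that satisfies $1\leq -24^{-1}_p\leq p-1$. *)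

(* Defs.v *)
From mathcomp Require Import all_boot all_order all_algebra.

Set Implicit Arguments.
Unset Strict Implicit.
Unset Printing Implicit Defensive.

Import Order.TTheory GRing.Theory Num.Theory.

(* A partition is the nonincreasing sequence of its positive parts. *)
Definition is_partition (n : nat) (s : seq nat) : bool :=
  [&& sorted geq s, all (leq 1) s & sumn s == n].

Definition regular (t : nat) (s : seq nat) : bool :=
  all (fun k => ~~ (t %| k)) s.

(* A partition of n has at most n parts, each at most n, so that n.-bseq 'I_n.+1
   contains every partition of n, exactly once. *)
Definition b_reg (t n : nat) : nat :=
  #|[set s : n.-bseq 'I_n.+1 | is_partition n (map val s)
                               && regular t (map val s)]|.

Local Open Scope ring_scope.

(* For a prime p >= 5 exactly one integer u satisfies this predicate; it is the
   negative representative of the inverse of 24 modulo p. *)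
Definition is_inv24 (p : nat) (u : int) : Prop :=
  (24%:Z * u = 1 %[mod p%:Z])%Z /\ 1 <= - u <= p%:Z - 1.

Definition inQ (p : nat) : Prop :=
  [/\ prime p, odd p
    & exists (j : nat) (x y : int),
        [/\ j \in [:: 1; 4; 8]%N, coprimez x y
          & 8%:Z * x ^+ 2 + 27%:Z * y ^+ 2 = (j * p)%N%:Z]].

(* The excluded value is compared with beta in the rationals, so that no
   rounding of the quotient is involved. *)
Definition excluded (p : nat) (u : int) : rat :=
  (11%:Z * (p%:Z ^+ 2 + 24%:Z * u - 1))%:~R / (24 * p)%N%:R.

(* Main.v *)
(* Write f_k for the product of the 1 - q^(ki).  Modulo 2, f_1^4 = f_4, so
   f_4 times the generating function f_21 / f_1 of b_21 is f_1^3 f_21.  By the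
   Jacobi triple product f_1^3 f_21 counts, at q^(4n+1), the solutions of
   x^2 + 7 y^2 = 16 (2n+1) with x, y odd and y prime to 3.  Up to conjugation
   x + y sqrt(-7) = pi^2 w with pi a prime above 2, and pi^2 w -> pi^2 w^*
   pairs these solutions off, except for x = 3y, whence
   sum b_21(4n+1) q^n = f_12 / f_1 = f_3 * (f_3^3 / f_1).  The triple product
   again gives f_3^3 / f_1 = sum over m prime to 3 of q^((m^2-1)/3), so that
   b_21(4n+1) has the parity of the number of m, y > 0 with
   8 m^2 + 3 y^2 = 24 n + 11 and y prime to 3.
   A prime p in Q is s^2 + 54 t^2 or 2 s^2 + 27 t^2.  If p divides 24 n + 11
   exactly once, then up to conjugation 4m + y sqrt(-6) is a multiple a w of
   a = s + 3t sqrt(-6), resp. 2s + 3t sqrt(-6), and a w -> a w^* pairs off the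
   solutions without fixed point.  The excluded beta is the one for which p^2
   divides 24 n + 11. *)
Require Import Defs.
From mathcomp Require Import all_boot all_order all_algebra.
From mathcomp Require Import zify ring.

Set Implicit Arguments.
Unset Strict Implicit.
Unset Printing Implicit Defensive.

Import Order.TTheory GRing.Theory Num.Theory.

Local Open Scope ring_scope.

(** * Truncated power series over F_2 *)

(** Congruence modulo ['X^K]: a power series is represented by any polynomial that agrees with it
    far enough. *)
Definition eqX (K : nat) (A B : {poly 'F_2}) : Prop :=
  forall i, (i < K)%N -> A`_i = B`_i.

Lemma eqX_sym K A B : eqX K A B -> eqX K B A.
Proof. by move=> AB i iK; rewrite AB. Qed.

Lemma eqX_trans K A B C : eqX K A B -> eqX K B C -> eqX K A C.
Proof. by move=> AB BC i iK; rewrite AB ?BC. Qed.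

Lemma eqX_leq K K' A B : (K' <= K)%N -> eqX K A B -> eqX K' A B.
Proof. by move=> leK AB i iK; apply/AB/(leq_trans iK). Qed.

Lemma eqX_mul K A A' B B' : eqX K A A' -> eqX K B B' -> eqX K (A * B) (A' * B').
Proof.
move=> eqA eqB i iK; rewrite !coefM; apply: eq_bigr => j _.
by rewrite eqA ?eqB // (leq_ltn_trans _ iK) ?leq_subr // -ltnS.
Qed.

(** Coefficient [i] of [A * B] is that of [B] plus terms in earlier coefficients of [B], so a series
    with constant term 1 can be divided out by induction on [i]. *)
Lemma eqX_cancel K (A B C : {poly 'F_2}) : A`_0 = 1 -> eqX K (A * B) (A * C) -> eqX K B C.
Proof.
move=> A0 eqABC; elim/ltn_ind => i IHi iK.
have := eqABC i iK; rewrite !coefM !big_ord_recl !subn0 A0 !mul1r.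
rewrite [X in _ + X = _](_ : _ =
   \sum_(j < i) A`_(lift ord0 j) * C`_(i - lift ord0 j)) => [/addIr //|].
apply: eq_bigr => j _; rewrite IHi //; first by case: j => j /= lt_ji; rewrite /bump; lia.
by apply: leq_ltn_trans iK; exact: leq_subr.
Qed.

Lemma polyF2_addrr (A : {poly 'F_2}) : A + A = 0.
Proof. by apply: addrr_pchar2; rewrite pchar_poly pchar_Fp. Qed.

(** The product f_k cut off after [N] factors; over F_2 the sign in 1 - q^(ki) disappears. *)
Definition eulerp (k N : nat) : {poly 'F_2} := \prod_(1 <= i < N.+1) (1 + 'X^(k * i)).

Lemma eulerpS k N : eulerp k N.+1 = eulerp k N * (1 + 'X^(k * N.+1)).
Proof. by rewrite /eulerp big_nat_recr. Qed.

Lemma eulerp_comp k N : eulerp k N = eulerp 1 N \Po 'X^k.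
Proof.
rewrite /eulerp rmorph_prod; apply: eq_bigr => i _ /=.
by rewrite mul1n rmorphD rmorph1 /= comp_Xn_poly exprM.
Qed.

(** Squaring is additive in characteristic 2, so it doubles the exponent in every factor. *)
Lemma eulerp_sqr k N : eulerp (k * 2) N = eulerp k N ^+ 2.
Proof.
rewrite /eulerp -prodrXl; apply: eq_bigr => i _.
by rewrite sqrrD expr1n mul1r mulr2n polyF2_addrr addr0 -exprM -mulnA (mulnC 2) mulnA.
Qed.

Lemma eulerp_0 k N : (0 < k)%N -> (eulerp k N)`_0 = 1.
Proof.
move=> k0; elim: N => [|N IHN]; first by rewrite /eulerp big_nil coef1.
rewrite eulerpS coef0M IHN mul1r coefD coef1 coefXn.
by case: (0%N =P (k * N.+1)%N) => [|_]; [nia | rewrite addr0].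
Qed.

Lemma eulerp_eqX k M N : (0 < k)%N -> (N <= M)%N -> eqX N.+1 (eulerp k M) (eulerp k N).
Proof.
move=> k0 /subnK <-; elim: (M - N)%N => // d IHd.
rewrite addSn eulerpS -[eulerp k N]mulr1; apply: eqX_mul => // i iN.
rewrite coefD coefXn; case: eqP => [iE|_]; last by rewrite addr0.
by move: iN; rewrite iE; nia.
Qed.

(** * Gaussian binomials and the finite triple product *)

(** The Gaussian binomial coefficient, given by its Pascal rule so that no division by 1 - q^i
    occurs. *)
Fixpoint qbinp (R : comPzRingType) (q : R) (n k : nat) : R :=
  match n, k with
  | _, 0 => 1
  | 0, _.+1 => 0
  | n'.+1, k'.+1 => qbinp q n' k' + q ^+ k * qbinp q n' k
  end.

Lemma qbinp_n0 (R : comPzRingType) (q : R) n : qbinp q n 0 = 1. Proof. by case: n. Qed.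

Lemma qbinp_small (R : comPzRingType) (q : R) n k : (n < k)%N -> qbinp q n k = 0.
Proof.
elim: n k => [|n IHn] [|k] //= lt_nk; rewrite !IHn ?mulr0 ?addr0 //.
exact: ltnW.
Qed.

(** The product formula cleared of denominators. The Pascal rule reduces it to 1 - q^(n+1) = (1 -
    q^(k+1)) + q^(k+1) (1 - q^(n-k)). *)
Lemma qbinp_pochhammer (R : comPzRingType) (q : R) n k : (k <= n)%N ->
  qbinp q n k * (\prod_(1 <= i < k.+1) (1 - q ^+ i)
     * \prod_(1 <= i < (n - k).+1) (1 - q ^+ i)) = \prod_(1 <= i < n.+1) (1 - q ^+ i).
Proof.
set P := fun m => \prod_(1 <= i < m.+1) (1 - q ^+ i).
have PS m : P m.+1 = P m * (1 - q ^+ m.+1) by rewrite /P big_nat_recr.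
have P0 : P 0%N = 1 by rewrite /P big_geq.
rewrite -/(P _) -/(P _) -/(P _).
elim: n k => [|n IHn] [|k] le_kn; rewrite ?qbinp_n0 ?P0 ?subn0 ?mul1r //.
rewrite subSS /= PS (PS n) mulrDl.
have -> : qbinp q n k * (P k * (1 - q ^+ k.+1) * P (n - k)%N) = P n * (1 - q ^+ k.+1).
  by rewrite -(IHn k le_kn); ring.
have [lt_kn|] := ltnP k n; last first.
  move=> le_nk; have {le_nk le_kn} -> : k = n by apply/eqP; rewrite eqn_leq le_nk andbT.
  by rewrite qbinp_small // mulr0 mul0r addr0.
have -> : (n - k = (n - k.+1).+1)%N by rewrite subnSK.
have -> : q ^+ n.+1 = q ^+ k.+1 * q ^+ (n - k.+1).+1.
  by rewrite -exprD addnS subnKC.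
by rewrite (PS (n - k.+1)%N) -(IHn k.+1 lt_kn) (PS k); ring.
Qed.

(** The q-binomial theorem, by splitting off the factor [i = 0] and replacing [z] by [z * q]. It is
    homogeneous because [y] later becomes ['X^(c * N)], which avoids negative powers of q. *)
Lemma qbinp_prod (R : comPzRingType) (q y z : R) n :
  \prod_(0 <= i < n) (y + z * q ^+ i) =
  \sum_(0 <= k < n.+1) q ^+ 'C(k, 2) * qbinp q n k * z ^+ k * y ^+ (n - k).
Proof.
elim: n z => [|n IHn] z; first by rewrite big_geq // big_nat1 !mulr1.
rewrite big_nat_recl //= (eq_bigr (fun i => y + z * q * q ^+ i)); last first.
  by move=> i _; rewrite exprS mulrA.
rewrite IHn expr0 mulr1 mulrDl !mulr_sumr.
rewrite [in RHS]big_nat_recl // expr0 !mulr1 !mul1r subn0.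
under [X in _ = _ + X]eq_bigr => k _ do rewrite /= mulrDr !mulrDl.
rewrite big_split /= addrA addrAC; congr (_ + _); last first.
  by apply: eq_bigr => k _; rewrite binS bin1 exprD subSS exprMn exprS; ring.
rewrite [in LHS]big_nat_recl // [in RHS]big_nat_recr //= (qbinp_small q (ltnSn n)) !(mulr0, mul0r) addr0.
rewrite qbinp_n0 !expr0 !mulr1 mul1r subn0 -exprS; congr (_ + _).
rewrite big_nat_cond [RHS]big_nat_cond; apply: eq_bigr => k /andP[/andP[_ lt_kn] _].
by rewrite exprMn subSS -(subnSK lt_kn) (exprS y); ring.
Qed.

Lemma polyF2_opp (A : {poly 'F_2}) : - A = A.
Proof. by apply/eqP; rewrite eq_sym -addr_eq0 polyF2_addrr. Qed.

Lemma eulerp_pochhammer c N : eulerp c N = \prod_(1 <= i < N.+1) (1 - ('X^c) ^+ i).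
Proof. by apply: eq_bigr => i _; rewrite polyF2_opp exprM. Qed.

(** The limit 1 / f_c of the Gaussian binomial: in the product formula all three Euler products
    agree with [eulerp c m] to this order. *)
Lemma eulerp_qbinp c m n k : (0 < c)%N -> (k <= n)%N ->
  (m <= k)%N -> (m <= n - k)%N ->
  eqX m.+1 (qbinp 'X^c n k * eulerp c m) 1.
Proof.
move=> c0 le_kn le_mk le_mnk.
have E M : (m <= M)%N -> eqX m.+1 (eulerp c m) (eulerp c M).
  by move=> le_mM; apply/eqX_sym/eulerp_eqX.
apply: (eqX_cancel (eulerp_0 m c0)); rewrite mulr1.
apply: (eqX_trans _ (eqX_sym (E n (leq_trans le_mk le_kn)))).
rewrite (eulerp_pochhammer c n) -(qbinp_pochhammer _ le_kn) -!eulerp_pochhammer mulrCA.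
by apply: eqX_mul => //; apply: eqX_mul; apply: E.
Qed.

Lemma bin2D m n : 'C(m + n, 2) = ('C(m, 2) + 'C(n, 2) + m * n)%N.
Proof.
by elim: n => [|n IHn]; rewrite ?bin0n ?muln0 ?addn0 // addnS !binS !bin1 IHn; lia.
Qed.

Lemma prod_Xn_arith (b c N : nat) :
  \prod_(0 <= i < N) ('X^(b + c * i) : {poly 'F_2}) = 'X^(c * 'C(N, 2) + b * N).
Proof.
elim: N => [|N IHN]; first by rewrite big_geq // bin0n !muln0.
rewrite big_nat_recr //= IHN -exprD; congr ('X^_).
by rewrite binS bin1; lia.
Qed.

(** Each factor with [i < N] gives up ['X^(b + c * i)], each other one ['X^(c * N)]; the cofactors
    run over the classes of -b and b modulo c. *)
Lemma jtp_prod (b c N : nat) : (0 < b < c)%N ->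
  \prod_(0 <= i < N + N) ('X^(c * N) + 'X^b * ('X^c) ^+ i) =
  'X^(c * (N * N) + (c * 'C(N, 2) + b * N)) *
  (\prod_(1 <= i < N.+1) (1 + 'X^(c * i - b))
   * \prod_(1 <= i < N.+1) (1 + 'X^(c * i - (c - b)))) :> {poly 'F_2}.
Proof.
move=> /andP[b0 lt_bc].
rewrite (big_cat_nat (n := N)) ?leq_addr //= exprD -prod_Xn_arith.
rewrite (_ : 'X^(c * (N * N)) = \prod_(0 <= i < N) 'X^(c * N)); last first.
  by rewrite prodr_const_nat subn0 -exprM mulnA.
rewrite -[X in \prod_(X <= i < N + N) _]add0n big_addn addnK.
rewrite !(big_add1 _ _ 0 N.+1) /= [X in _ * (X * _)]big_nat_rev /=.
rewrite mulrC [X in _ = _ * X]mulrC [RHS]mulrACA; congr (_ * _).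
  rewrite -big_split /=; apply: eq_bigr => i _.
  by rewrite mulrDr mulr1 -!exprM -!exprD; congr (_ + 'X^_); nia.
rewrite -big_split /= big_nat_cond [RHS]big_nat_cond; apply: eq_bigr => i /andP[/andP[_ iN] _].
rewrite mulrDr mulr1 -!exprM -!exprD addrC; congr ('X^_ + 'X^_); nia.
Qed.

(** * The Jacobi triple product *)

Lemma coefXnM_eqX1 (U : {poly 'F_2}) K m n :
  eqX K U 1 -> (n < m + K)%N -> ('X^m * U)`_n = (m == n)%:R.
Proof.
move=> U1 lt_n; rewrite coefXnM; case: ltnP => [lt_nm|le_mn].
  by rewrite gtn_eqF.
by rewrite U1 ?coef1; [congr (_%:R); apply/eqP/eqP; lia | lia].
Qed.

(** The Jacobi triple product modulo 2. In the q-binomial expansion of [jtp_prod] the terms [N + j]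
    and [N - j] have exponents [S] plus the two quadratic polynomials in [j]. *)
Lemma jtp_coef (b c N n : nat) : (0 < b < c)%N -> (n <= N)%N ->
  (eulerp c N * (\prod_(1 <= i < N.+1) (1 + 'X^(c * i - b))
   * \prod_(1 <= i < N.+1) (1 + 'X^(c * i - (c - b)))))`_n =
  \sum_(0 <= j < N.+1) (c * 'C(j, 2) + b * j == n)%N%:R
  + \sum_(1 <= j < N.+1) (c * 'C(j, 2) + (c - b) * j == n)%N%:R.
Proof.
move=> bc le_nN; have [b0 lt_bc] := andP bc.
set P := (X in _ * X); set S := (c * (N * N) + (c * 'C(N, 2) + b * N))%N.
have -> : (eulerp c N * P)`_n = ('X^S * P * eulerp c N)`_(S + n).
  by rewrite -mulrA coefXnM ltnNge leq_addr addKn mulrC.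
rewrite -jtp_prod // qbinp_prod mulr_suml coef_sum.
pose F k := (c * 'C(k, 2) + b * k + c * N * (N + N - k))%N.
have FE k : (k <= N + N)%N ->
    ('X^c ^+ 'C(k, 2) * qbinp 'X^c (N + N) k * 'X^b ^+ k * 'X^(c * N) ^+ (N + N - k)
     * eulerp c N : {poly 'F_2})
    = 'X^(F k) * (qbinp 'X^c (N + N) k * eulerp c N).
  by move=> _; rewrite /F !exprD !exprM; ring.
have Fup j : (j <= N)%N -> F (N + j)%N = (S + (c * 'C(j, 2) + b * j))%N.
  move=> le_jN; rewrite /F bin2D /S subnDl.
  have : (c * N * (N - j) + c * N * j = c * N * N)%N by rewrite -mulnDr subnK.
  lia.
have Fdown j : (j <= N)%N -> F (N - j)%N = (S + (c * 'C(j, 2) + (c - b) * j))%N.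
  move=> le_jN; have := bin2D (N - j) j; rewrite /F /S subnK // => ->.
  have -> : (N + N - (N - j) = N + j)%N by lia.
  have jj : (j * j = 2 * 'C(j, 2) + j)%N.
    by elim: j {le_jN} => // j IHj; rewrite binS bin1; lia.
  have [i ->] : exists i, N = (i + j)%N by exists (N - j)%N; rewrite subnK.
  have [a ->] : exists a, c = (b + a)%N by exists (c - b)%N; rewrite subnKC // ltnW.
  by rewrite addnK addKn; have := congr1 (muln (b + a)) jj; lia.
rewrite (big_cat_nat (n := N)) //=; last by lia.
rewrite addrC; congr (_ + _).
  rewrite -[X in \sum_(X <= i < _) _]add0n big_addn.
  rewrite (_ : ((N + N).+1 - N = N.+1)%N); last by lia.
  rewrite big_nat_cond [RHS]big_nat_cond; apply: eq_bigr => j /andP[/andP[_ jN] _].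
  rewrite FE; last by lia.
  (* The cofactor equals 1 only up to order [N - j], but its monomial lies at least [j] above [S],
     which suffices for [n <= N]. *)
  rewrite addnC Fup // (@coefXnM_eqX1 _ (N - j).+1); last by nia.
    by rewrite eqn_add2l.
  by apply: (eqX_trans _ (@eulerp_qbinp c (N - j) (N + N) (N + j) _ _ _ _));
     [apply: eqX_mul => //; apply: eulerp_eqX; lia | lia ..].
rewrite (big_add1 _ _ 0 N.+1) /= big_nat_rev /=.
rewrite big_nat_cond [RHS]big_nat_cond; apply: eq_bigr => j /andP[/andP[_ jN] _].
rewrite FE; last by lia.
rewrite add0n Fdown // (@coefXnM_eqX1 _ (N - j.+1).+1); last by nia.
  by rewrite eqn_add2l.
by apply: (eqX_trans _ (@eulerp_qbinp c (N - j.+1) (N + N) (N - j.+1) _ _ _ _));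
  [apply: eqX_mul => //; apply: eulerp_eqX; lia | lia ..].
Qed.

(** * Euler products as theta series *)

(** The [n] of the form (y^2 - 1) / D: generalized pentagonal numbers for D = 24, triangular numbers
    for D = 8. *)
Definition sqAP (D n : nat) : bool := [exists y : 'I_(D * n).+2, y ^ 2 == D * n + 1]%N.

Lemma sqAPP D n : reflect (exists y, y ^ 2 = D * n + 1)%N (sqAP D n).
Proof.
apply: (iffP existsP) => [[y /eqP] | [y yE]]; first by exists y.
have lt_y : (y < (D * n).+2)%N by nia.
by exists (Ordinal lt_y); rewrite /= yE.
Qed.

(** At most one [y >= 0] has y^2 = D n + 1. It is 1 or -1 modulo [u], not both since [u > 2], so
    exactly one term of one of the sums is 1; [j <= g1 j] and [j <= g2 j] keep that term in
    range. *)
Lemma sum_sqAP (D u N n : nat) (g1 g2 : nat -> nat) :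
  (2 < u)%N -> (n <= N)%N ->
  (forall j, D * g1 j + 1 = (u * j + 1) ^ 2)%N ->
  (forall j, (0 < j)%N -> D * g2 j + 1 = (u * j - 1) ^ 2)%N ->
  (forall j, j <= g1 j)%N -> (forall j, j <= g2 j)%N ->
  (forall y, y ^ 2 = 1 %[mod D] -> y = 1 %[mod u] \/ y.+1 = 0 %[mod u])%N ->
  \sum_(0 <= j < N.+1) (g1 j == n)%:R + \sum_(1 <= j < N.+1) (g2 j == n)%:R
  = (sqAP D n)%:R :> 'F_2.
Proof.
move=> u2 le_nN E1 E2 le1 le2 sqD.
have D0 : (0 < D)%N by have := E1 1%N; case: (D) => //; rewrite mul0n; nia.
have G1 j y : (y ^ 2 = D * n + 1)%N -> (g1 j == n) = (y == u * j + 1)%N.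
  by move=> yE; apply/eqP/eqP => H; have := E1 j; nia.
have G2 j y : (0 < j)%N -> (y ^ 2 = D * n + 1)%N -> (g2 j == n) = (y == u * j - 1)%N.
  by move=> j0 yE; apply/eqP/eqP => H; have := E2 j j0; nia.
have [/sqAPP[y yE]|/negP nsq] := boolP (sqAP D n); last first.
  rewrite big_nat_cond [X in _ + X]big_nat_cond !big1 ?addr0 // => j /andP[/andP[j0 _] _]; case: eqP => // E;
    case: nsq; apply/sqAPP.
    by exists (u * j - 1)%N; rewrite -E E2.
  by exists (u * j + 1)%N; rewrite -E E1.
rewrite (eq_bigr (fun j => (y == u * j + 1)%N%:R)); last by move=> j _; rewrite (G1 _ _ yE).
rewrite [X in _ + X](eq_big_nat _ _ (F2 := fun j => (y == u * j - 1)%N%:R)); last first.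
  by move=> j /andP[j0 _]; rewrite (G2 _ _ j0 yE).
have pick (m j0 : nat) (B : nat -> bool) : (m <= j0 <= N)%N ->
    (forall j, (m <= j)%N -> B j = (j == j0)) -> \sum_(m <= j < N.+1) (B j)%:R = 1 :> 'F_2.
  move=> j0N BE; rewrite (eq_big_nat _ _ (F2 := fun j => if j == j0 then 1 else 0)).
    by rewrite -big_mkcond big_nat1_eq ltnS j0N.
  by move=> j /andP[mj _]; rewrite BE //; case: eqP.
have none (m : nat) (B : nat -> bool) : (forall j, (m <= j)%N -> B j = false) ->
    \sum_(m <= j < N.+1) (B j)%:R = 0 :> 'F_2.
  by move=> BE; rewrite big_nat_cond big1 // => j /andP[/andP[mj _] _]; rewrite BE.
have [] := sqD y; first by rewrite yE mulnC modnMDl.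
  move=> y1; have {y1} : (u * (y %/ u) + 1 = y)%N.
    by rewrite mulnC [RHS](divn_eq y u) y1 [(1 %% u)%N]modn_small //; lia.
  set j0 := (y %/ u)%N => yj.
  have j0N : (j0 <= N)%N.
    by have := G1 j0 y yE; rewrite yj eqxx => /eqP g1n; have := le1 j0; lia.
  rewrite (pick 0%N j0) ?j0N // => [|j _]; last by apply/eqP/eqP; nia.
  by rewrite none ?addr0 // => j jpos; apply/eqP; have [|] := leqP j j0; nia.
move=> y1; have {y1} : (u * (y.+1 %/ u) = y.+1)%N.
  by rewrite mulnC [RHS](divn_eq y.+1 u) y1 mod0n addn0.
set j0 := (y.+1 %/ u)%N => yj.
have j0pos : (0 < j0)%N by nia.
have yj' : (y = u * j0 - 1)%N by lia.
have j0N : (j0 <= N)%N.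
  by have := G2 j0 y j0pos yE; rewrite -yj' eqxx => /eqP g2n; have := le2 j0; lia.
rewrite (pick 1%N j0) ?j0pos // => [|j jpos]; last by apply/eqP/eqP; nia.
by rewrite none ?add0r // => j _; apply/eqP; have [|] := leqP j0 j; nia.
Qed.

Lemma sqr_bin2 n : (n * n = 2 * 'C(n, 2) + n)%N.
Proof. by elim: n => // n IHn; rewrite binS bin1; lia. Qed.

(** The pentagonal number theorem: for b = 2, c = 3 the three products run over the residue classes
    modulo 3 and combine to f_1. *)
Lemma eulerp1_coef N n : (n <= N)%N -> (eulerp 1 N)`_n = (sqAP 24 n)%:R.
Proof.
move=> le_nN.
have E M : eulerp 3 M * (\prod_(1 <= i < M.+1) (1 + 'X^(3 * i - 2))
   * \prod_(1 <= i < M.+1) (1 + 'X^(3 * i - (3 - 2)))) = eulerp 1 (3 * M).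
  elim: M => [|M IHM]; first by rewrite /eulerp !big_geq // !mulr1.
  rewrite mulnS !addSn add0n !eulerpS -IHM !(big_nat_recr M.+1) //=.
  rewrite (_ : 3 * M.+1 - 2 = 1 * (3 * M).+1)%N; last by lia.
  rewrite (_ : 3 * M.+1 - (3 - 2) = 1 * (3 * M).+2)%N; last by lia.
  rewrite (_ : 3 * M.+1 = 1 * (3 * M).+3)%N; last by lia.
  by ring.
have lt3 : (N <= 3 * N)%N by rewrite leq_pmull.
have /(_ n le_nN) <- := @eulerp_eqX 1 (3 * N) N isT lt3; rewrite -E jtp_coef //.
apply: (@sum_sqAP 24 6) => // [j|j j0|j|j|y y2]; try by have := sqr_bin2 j; nia.
have := divn_eq y 6; have : (y %% 6 < 6)%N by rewrite ltn_mod.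
by move: (y %/ 6)%N (y %% 6)%N y2 => q [|[|[|[|[|[|//]]]]]] y2 _ yE; lia.
Qed.

(** Jacobi's formula for f_1^3. For b = 3, c = 4 the product [P] runs over odd exponents, so P = f_1
    / f_2 and f_4 P = f_1 f_4 / f_2 = f_1^3 modulo 2. *)
Lemma eulerp1_cube_coef N n : (n <= N)%N -> (eulerp 1 N ^+ 3)`_n = (sqAP 8 n)%:R.
Proof.
move=> le_nN.
pose P M : {poly 'F_2} := \prod_(1 <= i < M.+1) (1 + 'X^(4 * i - 3))
   * \prod_(1 <= i < M.+1) (1 + 'X^(4 * i - (4 - 3))).
have E M : eulerp 4 M * P M * eulerp 2 (2 * M) = eulerp 1 (4 * M) * eulerp 4 M.
  elim: M => [|M IHM]; first by rewrite /P /eulerp !big_geq // !mulr1.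
  have PS : P M.+1 = P M * ((1 + 'X^(1 * (4 * M).+1)) * (1 + 'X^(1 * (4 * M).+3))).
    rewrite /P !(big_nat_recr M.+1) //=.
    rewrite (_ : 4 * M.+1 - 3 = 1 * (4 * M).+1)%N; last by lia.
    rewrite (_ : 4 * M.+1 - (4 - 3) = 1 * (4 * M).+3)%N; last by lia.
    by ring.
  rewrite 2!mulnS !addSn !add0n !eulerpS PS.
  rewrite (_ : 2 * (2 * M).+1 = 1 * (4 * M).+2)%N; last by lia.
  rewrite (_ : 2 * (2 * M).+2 = 4 * M.+1)%N; last by lia.
  rewrite (_ : 1 * (4 * M).+4 = 4 * M.+1)%N; last by lia.
  ring: IHM.
have e0 := eulerp_0 N (ltn0Sn 0).
have stab k m : (0 < k)%N -> (0 < m)%N -> eqX N.+1 (eulerp k (m * N)) (eulerp k N).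
  by move=> k0 m0; apply: eulerp_eqX => //; rewrite leq_pmull.
have {E} EN : eqX N.+1 (eulerp 1 N ^+ 2 * (eulerp 4 N * P N)) (eulerp 1 N ^+ 2 * eulerp 1 N ^+ 3).
  have -> : eulerp 1 N ^+ 2 * eulerp 1 N ^+ 3 = eulerp 1 N * eulerp 4 N.
    by rewrite (eulerp_sqr 2) (eulerp_sqr 1); ring.
  rewrite -(eulerp_sqr 1) mulrC.
  apply: (eqX_trans (B := eulerp 4 N * P N * eulerp 2 (2 * N))).
    by apply: eqX_mul => //; apply/eqX_sym/stab.
  by rewrite E; apply: eqX_mul => //; apply: stab.
rewrite -(eqX_cancel _ EN) ?ltnS //; last by rewrite coef0M !e0 mulr1.
rewrite jtp_coef //; apply: (@sum_sqAP 8 4) => // [j|j j0|j|j|y y2]; try by have := sqr_bin2 j; nia.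
have := divn_eq y 4; have : (y %% 4 < 4)%N by rewrite ltn_mod.
by move: (y %/ 4)%N (y %% 4)%N y2 => q [|[|[|[|//]]]] y2 _ yE; lia.
Qed.

(** For b = 5, c = 6 the product [P] runs over exponents prime to 6, so P = f_1 f_6 / (f_2 f_3), and
    f_6 P = f_3^3 / f_1 modulo 2. *)
Lemma eulerp_theta3 N : exists G : {poly 'F_2},
  eqX N.+1 (eulerp 1 N * G) (eulerp 3 N ^+ 3) /\
  forall n, (n <= N)%N -> G`_n = (sqAP 3 n)%:R.
Proof.
pose P M : {poly 'F_2} := \prod_(1 <= i < M.+1) (1 + 'X^(6 * i - 5))
   * \prod_(1 <= i < M.+1) (1 + 'X^(6 * i - (6 - 5))).
exists (eulerp 6 N * P N); split; last first.
  move=> n le_nN; rewrite jtp_coef //.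
  apply: (@sum_sqAP 3 3) => // [j|j j0|j|j|y y2]; try by have := sqr_bin2 j; nia.
  have := divn_eq y 3; have : (y %% 3 < 3)%N by rewrite ltn_mod.
  by move: (y %/ 3)%N (y %% 3)%N y2 => q [|[|[|//]]] y2 _ yE; lia.
have E M : eulerp 6 M * P M * (eulerp 2 (3 * M) * eulerp 3 (2 * M))
    = eulerp 1 (6 * M) * eulerp 6 M ^+ 2.
  elim: M => [|M IHM]; first by rewrite /P /eulerp !big_geq // expr1n !mulr1.
  have PS : P M.+1 = P M * ((1 + 'X^(1 * (6 * M).+1)) * (1 + 'X^(1 * (6 * M).+1.+4))).
    rewrite /P !(big_nat_recr M.+1) //=.
    rewrite (_ : 6 * M.+1 - 5 = 1 * (6 * M).+1)%N; last by lia.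
    rewrite (_ : 6 * M.+1 - (6 - 5) = 1 * (6 * M).+1.+4)%N; last by lia.
    by ring.
  rewrite 3!mulnS !addSn !add0n !eulerpS PS.
  rewrite (_ : 2 * (3 * M).+1 = 1 * (6 * M).+2)%N; last by lia.
  rewrite (_ : 2 * (3 * M).+2 = 1 * (6 * M).+4)%N; last by lia.
  rewrite (_ : 2 * (3 * M).+3 = 6 * M.+1)%N; last by lia.
  rewrite (_ : 3 * (2 * M).+1 = 1 * (6 * M).+3)%N; last by lia.
  rewrite (_ : 3 * (2 * M).+2 = 6 * M.+1)%N; last by lia.
  rewrite (_ : 1 * (6 * M).+2.+4 = 6 * M.+1)%N; last by lia.
  ring: IHM.
have stab k m : (0 < k)%N -> (0 < m)%N -> eqX N.+1 (eulerp k (m * N)) (eulerp k N).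
  by move=> k0 m0; apply: eulerp_eqX => //; rewrite leq_pmull.
have H0 : (eulerp 1 N * eulerp 3 N)`_0 = 1 by rewrite coef0M !eulerp_0 ?mulr1.
apply: (eqX_cancel H0).
have -> : eulerp 1 N * eulerp 3 N * eulerp 3 N ^+ 3 = eulerp 1 N * eulerp 6 N ^+ 2.
  by rewrite (eulerp_sqr 3); ring.
have -> : eulerp 1 N * eulerp 3 N * (eulerp 1 N * (eulerp 6 N * P N))
   = eulerp 6 N * P N * (eulerp 2 N * eulerp 3 N).
  by rewrite (eulerp_sqr 1); ring.
apply: (eqX_trans (B := eulerp 6 N * P N * (eulerp 2 (3 * N) * eulerp 3 (2 * N)))).
  by apply: eqX_mul => //; apply: eqX_mul; apply/eqX_sym/stab.
by rewrite E; apply: eqX_mul => //; apply: stab.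
Qed.

(** * Generating function of regular partitions *)

Definition bounded_regular (t m n : nat) (s : seq nat) : bool :=
  [&& is_partition n s, regular t s & all (fun k => k <= m)%N s].

(* [f] is fuel: the enumeration is complete as soon as [m + n < f]. *)
Fixpoint regular_parts (t f m n : nat) : seq (seq nat) :=
  if f isn't f'.+1 then [::] else
  if m isn't m'.+1 then (if n == 0%N then [:: [::]] else [::]) else
  regular_parts t f' m' n ++
  (if ~~ (t %| m)%N && (m <= n)%N then map (cons m) (regular_parts t f' m (n - m)) else [::]).

Lemma bounded_regular_cons t m n x s : bounded_regular t m n (x :: s) =
  [&& (0 < x <= m)%N, (x <= n)%N, ~~ (t %| x)%N & bounded_regular t x (n - x) s].
Proof.
rewrite /bounded_regular /is_partition /regular /=.
have geq_trans : transitive geq by move=> a b c ab bc; apply: leq_trans bc ab.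
rewrite (path_sortedE geq_trans); apply/idP/idP.
  move=> /and3P[/and3P[/andP[le_sx srt] /andP[x0 pos] /eqP sE] /andP[tx reg] /andP[le_xm _]].
  have le_xn : (x <= n)%N by rewrite -sE leq_addr.
  by rewrite x0 le_xm le_xn tx srt pos reg le_sx -sE addKn eqxx.
move=> /and4P[/andP[x0 le_xm] le_xn tx /and3P[/and3P[srt pos /eqP sE] reg le_sx]].
rewrite srt x0 pos tx reg le_xm sE subnKC // eqxx andbT /= le_sx /=.
by apply: sub_all le_sx => k le_kx; apply: leq_trans le_xm.
Qed.

Lemma mem_regular_parts t f m n s : (m + n < f)%N ->
  (s \in regular_parts t f m n) = bounded_regular t m n s.
Proof.
elim: f m n s => [|f IHf] [|m] n s lt_f //=.
  case: s => [|x s]; last by rewrite bounded_regular_cons; case: eqP; case: x.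
  by rewrite /bounded_regular /is_partition /= eq_sym; case: eqP.
rewrite mem_cat IHf; last by lia.
case: s => [|x s].
  by rewrite {2}/bounded_regular /= orbC; case: ifP => // _; rewrite -[RHS]orFb; congr (_ || _); apply/mapP => -[].
rewrite !bounded_regular_cons.
have -> : (x :: s \in (if ~~ (t %| m.+1)%N && (m < n)%N
    then [seq m.+1 :: i | i <- regular_parts t f m.+1 (n - m.+1)] else [::])) =
  [&& x == m.+1, (x <= n)%N, ~~ (t %| x)%N & bounded_regular t x (n - x) s].
  case: ifP => [/andP[tm lt_mn]|ntm].
    apply/mapP/and4P => [[s' + [-> ->]]|[/eqP-> _ _ bs]].
      by rewrite IHf //; lia.
    by exists s => //; rewrite IHf //; lia.
  by rewrite in_nil; have [->|//] := eqVneq x m.+1; rewrite andTb andbA [X in X && _]andbC ntm.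
have [->|neq] := eqVneq x m.+1; first by rewrite ltnn leqnn.
by rewrite orbF [(x <= m.+1)%N]leq_eqVlt (negbTE neq).
Qed.

Lemma regular_parts_uniq t f m n : (m + n < f)%N -> uniq (regular_parts t f m n).
Proof.
elim: f m n => [|f IHf] [|m] n lt_f //=; first by case: eqP.
rewrite cat_uniq IHf /=; last by lia.
case: ifP => [/andP[_ le_mn]|] //; rewrite map_inj_uniq ?IHf ?andbT; [|lia|by move=> s s' []].
apply/hasPn => _ /mapP[s _ ->]; rewrite mem_regular_parts; last by lia.
by rewrite bounded_regular_cons ltnn andbF.
Qed.

Definition regular_count (t m n : nat) : nat := size (regular_parts t (m + n).+1 m n).

Lemma size_regular_parts t f m n : (m + n < f)%N ->
  size (regular_parts t f m n) = regular_count t m n.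
Proof.
move=> lt_f; apply/perm_size/uniq_perm => [||s]; rewrite ?regular_parts_uniq //.
by rewrite !mem_regular_parts.
Qed.

Lemma regular_count0 t n : regular_count t 0 n = (n == 0%N).
Proof. by rewrite /regular_count /=; case: eqP. Qed.

(** Partitions are split by whether [m.+1] occurs; if it does, one copy of it is removed. *)
Lemma regular_countS t m n : regular_count t m.+1 n =
  (regular_count t m n +
   if ~~ (t %| m.+1)%N && (m < n)%N then regular_count t m.+1 (n - m.+1) else 0)%N.
Proof.
have -> : regular_count t m.+1 n = size (regular_parts t (m.+1 + n) m n ++
    (if ~~ (t %| m.+1)%N && (m < n)%N
     then map (cons m.+1) (regular_parts t (m.+1 + n) m.+1 (n - m.+1)) else [::])) by [].
rewrite size_cat size_regular_parts; last by lia.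
congr (_ + _)%N; case: ifP => // /andP[_ lt_mn].
by rewrite size_map size_regular_parts //; lia.
Qed.

Lemma size_le_sumn (s : seq nat) : all (leq 1) s -> (size s <= sumn s)%N.
Proof. by elim: s => //= x s IHs /andP[x0 /IHs]; lia. Qed.

Lemma all_le_sumn (s : seq nat) : all (fun k => k <= sumn s)%N s.
Proof.
elim: s => //= x s IHs; rewrite leq_addr /=.
by apply: sub_all IHs => k le_k; apply: leq_trans le_k (leq_addl _ _).
Qed.

(** No part of a partition of [n] exceeds [n], so the bound [m] excludes nothing, and [inord] loses
    nothing when parts are put back into ['I_n.+1]. *)
Lemma b_reg_count t m n : (n <= m)%N -> b_reg t n = regular_count t m n.
Proof.
move=> le_nm; rewrite /b_reg cardE.
set A := [set _ | _]; pose g (s : n.-bseq 'I_n.+1) := map val s.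
rewrite -(size_map g); apply/perm_size/uniq_perm.
- rewrite map_inj_uniq ?enum_uniq // => s1 s2 /(inj_map val_inj); exact: val_inj.
- by rewrite regular_parts_uniq.
move=> s; rewrite mem_regular_parts // /bounded_regular andbA.
apply/mapP/andP => [[s' + ->]|[ps le_sm]].
  rewrite mem_enum inE => /andP[ps rs]; rewrite ps rs; split=> //.
  have /and3P[_ _ /eqP sE] := ps; have := all_le_sumn (g s'); rewrite sE.
  by apply: sub_all => k le_kn; apply: leq_trans le_nm.
have [/and3P[_ pos /eqP sE] _] := andP ps.
have size_s : (size (map (@inord n) s) <= n)%N by rewrite size_map -sE size_le_sumn.
have gE : g (Bseq size_s) = s.
  rewrite /g /= -map_comp; apply/map_id_in => k ks /=; rewrite inordK // ltnS.
  by have /allP/(_ k ks) := all_le_sumn s; rewrite sE.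
by exists (Bseq size_s); rewrite ?gE // mem_enum inE -/(g _) gE.
Qed.

(** Multiplying [C m], which counts regular partitions into parts up to [m], by all 1 + q^i with i
    up to m leaves only the factors with t dividing i. The choice [m = t * N] makes these exactly
    [eulerp t N]. *)
Lemma regular_poly t N : (0 < t)%N -> exists B : {poly 'F_2},
  eqX N.+1 (B * eulerp 1 N) (eulerp t N) /\  forall n, (n <= N)%N -> B`_n = (b_reg t n)%:R.
Proof.
move=> t0; pose C m : {poly 'F_2} := \poly_(n < N.+1) (regular_count t m n)%:R.
have CE m n : (n < N.+1)%N -> (C m)`_n = (regular_count t m n)%:R.
  by move=> lt_nN; rewrite coef_poly lt_nN.
have le_NtN : (N <= t * N)%N by rewrite leq_pmull.
exists (C (t * N)%N); split; last first.
  by move=> n le_nN; rewrite CE // (b_reg_count _ (leq_trans le_nN le_NtN)).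
have CS m : eqX N.+1 (C m.+1 * (if (t %| m.+1)%N then 1 else 1 + 'X^(m.+1))) (C m).
  move=> n lt_nN; case: ifP => tm.
    by rewrite mulr1 !CE // regular_countS tm addn0.
  rewrite mulrDr mulr1 coefD coefMXn !CE //; last by lia.
  rewrite regular_countS tm /= ltnS.
  case: leqP => [_|lt_mn]; first by rewrite addn0 addr0.
  rewrite natrD -addrA [X in _ + X](_ : _ = 0) ?addr0 //.
  by apply: addrr_pchar2; apply: pchar_Fp.
have CP m : eqX N.+1 (C m * \prod_(1 <= i < m.+1) (1 + 'X^(1 * i)))
    (\prod_(1 <= i < m.+1 | (t %| i)%N) (1 + 'X^i)).
  elim: m => [|m IHm].
    rewrite !big_geq // mulr1 => n lt_nN; rewrite CE // regular_count0 coef1.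
    by case: eqP.
  rewrite [X in eqX _ _ X]big_mkcond !(big_nat_recr m.+1) //= -big_mkcond mul1n.
  case: ifP (CS m) => _ CSm; last first.
    by rewrite mulr1 mulrCA mulrC; apply: eqX_trans IHm; apply: eqX_mul.
  rewrite mulr1 in CSm; rewrite mulrA; apply: eqX_mul => //.
  by apply: eqX_trans IHm; apply: eqX_mul.
apply: (eqX_trans (B := C (t * N)%N * eulerp 1 (t * N))).
  by apply: eqX_mul => //; apply/eqX_sym/eulerp_eqX.
apply: eqX_trans (CP _) _.
suff -> : \prod_(1 <= i < (t * N).+1 | (t %| i)%N) (1 + 'X^i) = eulerp t N by [].
elim: N {C CE le_NtN CS CP} => [|N IHN]; first by rewrite /eulerp muln0 !big_geq.
have tS : (t * N.+1 = t * N + t)%N by rewrite mulnS addnC.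
rewrite eulerpS -IHN tS (big_cat_nat (n := (t * N).+1)) //=; last by lia.
congr (_ * _); case: t t0 tS {IHN} => // t _ tS.
rewrite addnS big_mkcond big_nat_recr //=; last by lia.
rewrite -addnS -tS dvdn_mulr // big_nat_cond big1 ?mul1r //.
move=> i /andP[/andP[lt1 lt2] _]; case: ifP => // /dvdnP[k iE].
by have [|] := leqP k N; nia.
Qed.

(** * Involutions on solutions of binary quadratic equations *)

Lemma odd_size_involution (T : eqType) (s : seq T) (f : T -> T) : uniq s ->
  {in s, forall x, f x \in s} -> {in s, forall x, f (f x) = x} ->
  odd (size s) = odd (count (fun x => f x == x) s).
Proof.
have [n] := ubnP (size s); elim: n s => // n IHn [|x s] //= lt_n /andP[xs us] fs ff.
have fxs : f x \in x :: s by apply: fs; rewrite mem_head.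
have fneq y : y \in s -> f y != f x.
  move=> ys; apply: contra_neq (memPn xs y ys) => eq_f.
  by rewrite -(ff y) ?eq_f ?ff ?inE ?eqxx ?ys ?orbT.
have [fx|neq_fx] := eqVneq (f x) x.
  rewrite add1n /=; congr (~~ _); apply: IHn => // y ys; last first.
    by apply: ff; rewrite inE ys orbT.
  have := fs y; rewrite !inE ys orbT => /(_ isT) /orP[/eqP fy|//].
  by have := fneq y ys; rewrite fx fy eqxx.
have {fxs} fxs : f x \in s by move: fxs; rewrite inE (negbTE neq_fx).
have eq_s := perm_to_rem fxs; have us' := rem_uniq (f x) us.
have ffx : f (f x) = x by apply: ff; rewrite mem_head.
rewrite add0n (permP eq_s) (perm_size eq_s) /= ffx eq_sym (negbTE neq_fx) add0n negbK.
apply: IHn => // [|y|y]; rewrite ?mem_rem_uniq ?inE //.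
- by move: lt_n; rewrite (perm_size eq_s) /=; lia.
- move=> /andP[yfx ys]; rewrite fneq //=.
  have := fs y; rewrite !inE ys orbT => /(_ isT) /orP[/eqP fy|//].
  by move: yfx; rewrite -fy ff ?eqxx // inE ys orbT.
- by move=> /andP[_ ys]; apply: ff; rewrite inE ys orbT.
Qed.

(* [(x, y)] runs over points up to signs.  Exactly one of [(x, y)], [(x, -y)]
   has its linear form [a x + b y] divisible by [m]; reflecting that one in the
   line [a x + b y = 0] is an involution. *)
Lemma odd_size_reflection (a b m al be : int) (s : seq (nat * nat)) (P : pred (nat * nat)) :
  m != 0 -> a * al + b * be = - (2 * m) -> uniq s ->
  (forall x y : nat, (x, y) \in s ->
    (m %| a * x%:Z + b * y%:Z)%Z (+) (m %| a * x%:Z - b * y%:Z)%Z) ->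
  (forall x y k : int, (absz x, absz y) \in s -> a * x + b * y = m * k ->
    ((absz (x + al * k), absz (y + be * k)) \in s) /\
    ((absz (x + al * k), absz (y + be * k)) == (absz x, absz y)) = P (absz x, absz y)) ->
  odd (size s) = odd (count P s).
Proof.
move=> m0 refl us one_sign stable.
pose absp (v : int * int) : nat * nat := (absz v.1, absz v.2).
pose shift (v : int * int) (k : int) : int * int := (v.1 + al * k, v.2 + be * k).
pose lift (u : nat * nat) : int * int :=
  if (m %| a * u.1%:Z + b * u.2%:Z)%Z then (u.1%:Z, u.2%:Z) else (u.1%:Z, - u.2%:Z).
pose quo (v : int * int) : int := ((a * v.1 + b * v.2) %/ m)%Z.
pose f (u : nat * nat) : nat * nat := absp (shift (lift u) (quo (lift u))).
have lift_abs u : absp (lift u) = u.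
  by case: u => x y; rewrite /lift /absp; case: ifP => _ /=; rewrite ?abszN.
have lift_quo u : u \in s -> a * (lift u).1 + b * (lift u).2 = m * quo (lift u).
  case: u => x y xy; rewrite /quo [RHS]mulrC divzK //; have := one_sign x y xy.
  by rewrite /lift /=; case: ifP => //= _; rewrite mulrN.
(* Only one relative sign passes the divisibility test, so [lift] recovers a passing point up to a
   global sign. *)
have lift_of_abs (x y k : int) : (absz x, absz y) \in s -> a * x + b * y = m * k ->
    lift (absz x, absz y) = (x, y) \/ lift (absz x, absz y) = (- x, - y).
  move=> xy E; have dv : (m %| a * x + b * y)%Z by rewrite E dvdz_mulr.
  have dvN : (m %| a * - x - b * y)%Z by rewrite mulrN -opprD rpredN.
  have := one_sign _ _ xy; rewrite /lift /= !abszE.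
  case: (ger0P x) => x0; case: (ger0P y) => y0; rewrite ?mulrN ?opprK.
  - by rewrite dv; left.
  - by case: ifP => [dv' | _ _]; [rewrite dv | left].
  - by case: ifP => [dv' | _ _]; [rewrite -mulrN dvN | right].
  - by rewrite -mulrN dvN; right.
have fE u : u \in s -> f u \in s /\ (f u == u) = P u.
  move=> u_s; have := @stable (lift u).1 (lift u).2 (quo (lift u)).
  by have := lift_abs u; rewrite /absp => -> /(_ u_s (lift_quo u u_s)).
have ff : {in s, forall u, f (f u) = u}.
  move=> u u_s; have [fu_s _] := fE u u_s.
  set k := quo (lift u); have E : _ = m * k := lift_quo u u_s.
  pose x := (lift u).1 + al * k; pose y := (lift u).2 + be * k.
  (* By [refl] the shift turns the quotient [k] into [- k], so a second shift undoes the first. *)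
  have Exy : a * x + b * y = m * - k.
    have -> : a * x + b * y = a * (lift u).1 + b * (lift u).2 + (a * al + b * be) * k.
      by rewrite /x /y; ring.
    by rewrite E refl; ring.
  have quoE (z w j : int) : a * z + b * w = m * j -> quo (z, w) = j.
    by move=> Ej; rewrite /quo /= Ej mulrC mulzK.
  rewrite -[RHS]lift_abs.
  have [lE|lE] := lift_of_abs _ _ _ fu_s Exy; rewrite /f -/k -/x -/y lE /absp /shift /=.
    by rewrite (quoE _ _ _ Exy) /x /y !mulrN !addrK.
  rewrite (quoE (- x) (- y) k); last by rewrite !mulrN -opprD Exy mulrN opprK.
  have -> : - x + al * k = - (lift u).1 by rewrite /x; ring.
  have -> : - y + be * k = - (lift u).2 by rewrite /y; ring.
  by rewrite !abszN.
rewrite (@odd_size_involution _ _ f) //; last by move=> u /fE[].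
by congr odd; apply: eq_in_count => u /fE[].
Qed.

(** * Products of two theta series *)

Lemma big_nat_dvdn (R : Type) (idx : R) (op : Monoid.law idx) (F : nat -> R) (k r i : nat) :
  (r < k)%N ->
  \big[op/idx]_(0 <= m < (k * i + r).+1 | (k %| m)%N) F m = \big[op/idx]_(0 <= j < i.+1) F (k * j)%N.
Proof.
move=> lt_rk; have block j m : (k * j + r < m < (k * j.+1 + r).+1)%N ->
    (k %| m)%N = (m == k * j.+1)%N.
  move=> lt_m; apply/dvdnP/eqP => [[q mE]|->]; last by exists j.+1; rewrite mulnC.
  rewrite mE mulnC; congr (_ * _)%N; nia.
elim: i => [|i IHi].
  rewrite muln0 add0n big_mkcond big_nat_recl // dvdn0 !big_nat1 muln0 -[RHS](Monoid.mulm1 op).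
  congr (op _ _); rewrite big_nat_cond big1 // => m /andP[/andP[_ lt_mr] _].
  by rewrite gtnNdvd //; lia.
rewrite (big_cat_nat (n := (k * i + r).+1)) //=; last by rewrite ltnS leq_add2r leq_mul2l leqnSn orbT.
rewrite IHi [RHS]big_nat_recr //=; congr (op _ _).
rewrite big_nat_cond (eq_bigl (fun m => ((k * i + r < m < (k * i.+1 + r).+1) && (m == k * i.+1))%N)).
  by rewrite -big_nat_cond big_nat1_eq (_ : (_ < _ < _)%N = true) //; nia.
by move=> m; case lt_m: (_ < m < _)%N => //=; rewrite (block i m lt_m).
Qed.

(** A factor that is a series in q^k passes through the extraction of the exponents k i + r,
    becoming [A] itself. *)
Lemma coef_comp_XnM (A B : {poly 'F_2}) (k r i : nat) : (r < k)%N ->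
  ((A \Po 'X^k) * B)`_(k * i + r) = \sum_(0 <= j < i.+1) A`_j * B`_(k * (i - j) + r).
Proof.
move=> lt_rk; have k0 : (0 < k)%N by lia.
rewrite coefM -(big_mkord xpredT (fun j => (A \Po 'X^k)`_j * B`_(k * i + r - j))) .
rewrite (eq_bigr (fun m => if (k %| m)%N then A`_(m %/ k) * B`_(k * i + r - m) else 0)).
  rewrite -big_mkcond big_nat_dvdn // !big_mkord; apply: eq_bigr => j _.
  rewrite mulKn //; congr (_ * _`__); have := ltn_ord j; rewrite ltnS mulnBr => le_ji.
  by rewrite addnBAC // leq_mul2l le_ji orbT.
by move=> m _; rewrite coef_comp_poly_Xn //; case: ifP; rewrite ?mul0r.
Qed.

Lemma eq1_modP D m : (1 < D)%N ->
  reflect (exists i, m = D * i + 1)%N (m == 1 %[mod D])%N.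
Proof.
move=> D1; apply: (iffP eqP) => [E|[i ->]]; last by rewrite mulnC modnMDl.
by exists (m %/ D)%N; rewrite {1}(divn_eq m D) E modn_small // mulnC.
Qed.

(* The [x, y >= 0] with [(x ^ 2 - 1) / D + k * ((y ^ 2 - 1) / 24) = n]. *)
Definition theta_reps (D k n : nat) : seq (nat * nat) :=
  let M := (24 * (D * n) + D * k + 24)%N in
  [seq u <- [seq (x, y) | x <- iota 0 M.+1, y <- iota 0 M.+1] |
    [&& u.1 ^ 2 == 1 %[mod D], u.2 ^ 2 == 1 %[mod 24]
      & 24 * u.1 ^ 2 + D * k * u.2 ^ 2 == M]%N].

Lemma theta_reps_uniq D k n : uniq (theta_reps D k n).
Proof.
apply: filter_uniq; apply: allpairs_uniq; rewrite ?iota_uniq //.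
by case=> x y [x' y'] _ _ [-> ->].
Qed.

Lemma mem_theta_reps D k n x y : (0 < D)%N -> (0 < k)%N ->
  ((x, y) \in theta_reps D k n) =
  [&& x ^ 2 == 1 %[mod D], y ^ 2 == 1 %[mod 24]
    & 24 * x ^ 2 + D * k * y ^ 2 == 24 * (D * n) + D * k + 24]%N.
Proof.
move=> D0 k0; rewrite mem_filter; apply: andb_idr => /and3P[_ _ /eqP E].
have {}E : (24 * x ^ 2 + D * k * y ^ 2 = 24 * (D * n) + D * k + 24)%N := E.
have Dk0 : (0 < D * k)%N by rewrite muln_gt0 D0.
apply/allpairsPdep; exists x, y; rewrite !mem_iota !add0n; split=> //; first by nia.
by have : (y <= D * k * y ^ 2)%N; [case: (y) => // z; nia | lia].
Qed.

Lemma eulerp_coef N k n : (0 < k)%N -> (n <= N)%N ->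
  (eulerp k N)`_n = ((k %| n)%N && sqAP 24 (n %/ k))%:R.
Proof.
move=> k0 le_nN; rewrite eulerp_comp coef_comp_poly_Xn //; case: ifP => //= kn.
by rewrite eulerp1_coef // (leq_trans (leq_div _ _)).
Qed.

(** Both factors have coefficients 0 and 1, so the coefficient counts the splittings of [n] marked
    by [c]. As x and y are nonnegative, (x, y) -> (x^2 - 1) / D is a bijection onto the marked
    indices. *)
Lemma coef_theta_eulerp (A : {poly 'F_2}) (D k N n : nat) : (1 < D)%N -> (0 < k)%N ->
  (n <= N)%N -> (forall i, (i <= n)%N -> A`_i = (sqAP D i)%:R) ->
  (A * eulerp k N)`_n = (size (theta_reps D k n))%:R.
Proof.
move=> D1 k0 le_nN AE; have D0 : (0 < D)%N by apply: ltnW.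
pose c i := [&& sqAP D i, (k %| n - i)%N & sqAP 24 ((n - i) %/ k)].
rewrite coefM -(big_mkord xpredT (fun j => A`_j * (eulerp k N)`_(n - j))).
rewrite (eq_big_nat _ _ (F2 := fun i => if c i then 1 else 0)); last first.
  move=> i /andP[_ lt_in]; rewrite AE // eulerp_coef //; last by lia.
  by rewrite -natrM mulnb /c; case: ifP.
have -> : (size (theta_reps D k n) = size [seq i <- index_iota 0 n.+1 | c i])%N.
  rewrite -(size_map (fun u => (u.1 ^ 2 - 1) %/ D)%N); apply/perm_size/uniq_perm.
  - rewrite map_inj_in_uniq ?theta_reps_uniq // => -[x y] [x' y'].
    rewrite !mem_theta_reps //= => /and3P[/(eq1_modP _ D1)[i xE] _ /eqP E].
    move=> /and3P[/(eq1_modP _ D1)[i' x'E] _ /eqP E'].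
    rewrite xE x'E !addnK !mulKn // => eq_i; rewrite -{i'}eq_i -xE in x'E.
    have /eqP eq_x : (x' == x)%N by rewrite -(eqn_exp2r _ _ (ltn0Sn 1)) x'E.
    have : (D * k * y ^ 2 == D * k * y' ^ 2)%N by lia.
    by rewrite eqn_pmul2l ?muln_gt0 ?D0 // eqn_exp2r // eq_x => /eqP ->.
  - by rewrite filter_uniq ?iota_uniq.
  move=> i; rewrite mem_filter mem_index_iota ltnS /=; apply/mapP/andP; last first.
    move=> [/and3P[/sqAPP[x xE] ki /sqAPP[y yE]] le_in]; exists (x, y) => /=; last first.
      by rewrite xE addnK mulKn.
    rewrite mem_theta_reps // xE yE; apply/and3P; split.
    - by apply/(eq1_modP _ D1); exists i.
    - by apply/(@eq1_modP 24); [|exists ((n - i) %/ k)%N].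
    apply/eqP; rewrite -[in RHS](subnKC le_in) -{2}(divnK ki); ring.
  move=> [[x y] + ->]; rewrite mem_theta_reps // => /and3P[/(eq1_modP _ D1)[j xE]].
  move=> /(@eq1_modP 24 _ isT)[l yE] /eqP; rewrite /= xE yE addnK mulKn // => E.
  have {E} nE : (n = j + k * l)%N.
    by apply/eqP; rewrite -(eqn_pmul2l D0); apply/eqP; lia.
  rewrite /c nE leq_addr addKn dvdn_mulr // mulKn //; split=> //; apply/andP; split.
    by apply/sqAPP; exists x.
  by apply/sqAPP; exists y.
by rewrite -big_mkcond size_filter -sum1_count natr_sum.
Qed.

Lemma F2_natr_odd n : n%:R = (odd n)%:R :> 'F_2.
Proof.
rewrite -[in LHS](odd_double_half n) natrD -addnn natrD.
by rewrite (@addrr_pchar2 'F_2 (@pchar_Fp 2 isT)) addr0.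
Qed.

Lemma mem_theta_reps_int D k n (x y : int) : (1 < D)%N -> (0 < k)%N ->
  (absz x, absz y) \in theta_reps D k n <->
  [/\ exists i, x ^+ 2 = D%:Z * i + 1, exists l, y ^+ 2 = 24 * l + 1
    & 24 * x ^+ 2 + (D * k)%N%:Z * y ^+ 2 = (24 * (D * n) + D * k + 24)%N%:Z].
Proof.
move=> D1 k0; rewrite mem_theta_reps //; last exact: ltnW.
have sq (z : int) : ((absz z ^ 2)%N : int) = z ^+ 2.
  by rewrite PoszM -expr2 abszE real_normK // num_real.
split=> [/and3P[/(eq1_modP _ D1)[i xE] /(@eq1_modP 24 _ isT)[l yE] /eqP E]|].
  rewrite -!sq; split; [exists i%:Z | exists l%:Z |].
  - by rewrite xE PoszD PoszM.
  - by rewrite yE PoszD PoszM.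
  - by rewrite -E PoszD !PoszM.
move=> [[i xE] [l yE] E]; have D0 : 0 < D%:Z by apply: ltnW.
have x2 := sqr_ge0 x; have y2 := sqr_ge0 y; rewrite -!sq in xE yE E x2 y2.
apply/and3P; split.
- by apply/(eq1_modP _ D1); exists (absz i); nia.
- by apply/(@eq1_modP 24); [|exists (absz l); lia].
- by apply/eqP; lia.
Qed.

(** * The parity of b_21(4n+1) *)

Lemma odd_sqr_int (z i : int) : z ^+ 2 = 2 * i + 1 -> exists w, z = 2 * w + 1.
Proof.
have [w [zE|zE]] : exists w, z = 2 * w \/ z = 2 * w + 1 by exists (z %/ 2)%Z; lia.
  by rewrite zE; lia.
by exists w.
Qed.

Lemma even_mul_sub (k y b : int) : y = 2 * b + 1 -> exists h, k * (k - y) = 2 * h.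
Proof.
move=> ->; have [w [->|->]] : exists w, k = 2 * w \/ k = 2 * w + 1 by exists (k %/ 2)%Z; lia.
  by exists (w * (2 * w - (2 * b + 1))); ring.
by exists ((2 * w + 1) * (w - b)); ring.
Qed.

(** The equation is x^2 + 7 y^2 = 32 n + 16. A solution with x = 3y has y^2 = 2n + 1, and y^2 = 1
    modulo 24 then gives n = 12 l with 24 l + 1 = y^2. *)
Lemma odd_size_theta_reps_21 n :
  odd (size (theta_reps 8 21 (4 * n + 1))) = (12 %| n)%N && sqAP 24 (n %/ 12).
Proof.
set s := theta_reps _ _ _.
have memE x y : (absz x, absz y) \in s <->
    [/\ exists i, x ^+ 2 = 8 * i + 1, exists l, y ^+ 2 = 24 * l + 1
    & x ^+ 2 + 7 * y ^+ 2 = 32 * n%:Z + 16].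
  by rewrite mem_theta_reps_int //; split=> -[? ? ?]; split=> //; lia.
have memN (x y : nat) := memE x y.
(* With x + 3y = 16k, the map to (x - 14k, y - 6k) is the reflection in the line x + 3y = 0 for the
   form x^2 + 7 y^2. *)
rewrite (@odd_size_reflection 1 3 16 (-14) (-6) s (fun u => u.1 == 3 * u.2)%N) //.
- have [/andP[/dvdnP[m nE] /sqAPP[y yE]]|/negP nsq] := boolP (_ && _); last first.
    rewrite [X in odd X](_ : _ = 0%N) //; apply/eqP; rewrite -leqn0 leqNgt -has_count.
    apply/negP => /hasP[[x y] /memN[_ [l yE] E] /= /eqP xE]; apply: nsq.
    have nE : n%:Z = 12 * l by rewrite xE in E; lia.
    have {}nE : n = (12 * absz l)%N by lia.
    rewrite nE dvdn_mulr // mulKn //; apply/sqAPP; exists y; lia.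
  rewrite nE mulnK // in yE.
  rewrite (@eq_in_count _ _ (pred1 (3 * y, y)%N)); last first.
    move=> [x' y'] /memN[_ _ E] /=; rewrite xpair_eqE.
    apply/eqP/andP => [x'E|[/eqP-> /eqP->] //].
    have y'E : y' = y.
      by apply/eqP; rewrite -(eqn_exp2r _ _ (ltn0Sn 1)); apply/eqP; rewrite x'E in E; lia.
    by rewrite x'E y'E.
  rewrite count_uniq_mem ?theta_reps_uniq // (_ : _ \in s = true) //.
  apply/(memN (3 * y)%N y); split.
  + by exists (27 * m%:Z + 1); lia.
  + by exists m%:Z; lia.
  + by lia.
- exact: theta_reps_uniq.
- move=> x y /memN[[i xE] [l yE] E].
  have [a aE] : exists a : int, x%:Z = 2 * a + 1.
    by apply: (@odd_sqr_int _ (4 * i)); lia.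
  have [b bE] : exists b : int, y%:Z = 2 * b + 1.
    by apply: (@odd_sqr_int _ (12 * l)); lia.
  (* Here x^2 - 9 y^2 = 32 (n - 12 l) is 4cd. As c + d is odd, one of c, d is odd and the other
     carries the whole factor 8. *)
  have [c [d [-> -> cd odd_cd]]] : exists c d : int,
      [/\ 1 * x%:Z + 3 * y%:Z = 2 * c, 1 * x%:Z - 3 * y%:Z = 2 * d,
        c * d = 8 * (n%:Z - 12 * l) & c + d = x].
    by exists (a + 3 * b + 2), (a - 3 * b - 1); split; lia.
  rewrite (_ : 16 = 2 * 8) // !dvdz_mul2l //.
  have dv : (8 %| c * d)%Z by rewrite cd dvdz_mulr.
  have cop (z : int) : ~~ (2 %| z)%Z -> coprimez 8 z.
    by move=> nz; rewrite (_ : 8 = 2 ^+ 3) // coprimezXl // coprimezE coprime2n -[odd _]negbK -dvdn2.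
  have [c2|nc2] := boolP (2 %| c)%Z.
    have nd2 : ~~ (2 %| d)%Z.
      by apply/dvdzP => -[d' dE]; have /dvdzP[c' cE] := c2; lia.
    move: dv; rewrite Gauss_dvdzl ?cop // => ->; apply/dvdzP => -[d' dE].
    by move/dvdzP: nd2; apply; exists (4 * d'); lia.
  move: dv; rewrite Gauss_dvdzr ?cop // => ->; rewrite addbT; apply/dvdzP => -[c' cE].
  by move/dvdzP: nc2; apply; exists (4 * c'); lia.
move=> x y k /memE[[i xE] [l yE] E] kE.
have [b bE] : exists b : int, y = 2 * b + 1 by apply: (@odd_sqr_int _ (12 * l)); lia.
(* (y - 6k)^2 = y^2 + 12 k (k - y) + 24 k^2, so evenness of k (k - y) preserves y^2 modulo 24;
   similarly for x^2 modulo 8. *)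
have [h hE] := even_mul_sub k bE.
split.
  apply/memE; split.
  - by exists (i - 21 * h - 21 * k ^+ 2); lia.
  - by exists (l + h + k ^+ 2); lia.
  - have -> : x = 16 * k - 3 * y by lia.
    by rewrite -E (_ : x = 16 * k - 3 * y); [ring | lia].
apply/eqP/eqP => [[_ yE']|/= xE'].
  have : k = 0 \/ y = 3 * k by clear - yE'; lia.
  by case=> [k0|y3] /=; [clear - k0 kE; lia | rewrite y3 in yE; lia].
have : k = 0 by clear - xE' kE bE; lia.
by move=> ->; rewrite !mulr0 !addr0.
Qed.

(** [theta_reps 3 3 n] holds the solutions of 8 x^2 + 3 y^2 = 24 n + 11. *)
Lemma b_reg21_theta n :
  (b_reg 21 (4 * n + 1))%:R = (size (theta_reps 3 3 n))%:R :> 'F_2.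
Proof.
pose N := (4 * n + 1)%N.
have [B [Bf BE]] := @regular_poly 21 N isT; have [G [Gf GE]] := eulerp_theta3 N.
have f0 := eulerp_0 N (ltn0Sn 0).
have sec : eqX N.+1 (eulerp 4 N * B) (eulerp 1 N ^+ 3 * eulerp 21 N).
  have -> : eulerp 4 N * B = eulerp 1 N ^+ 3 * (B * eulerp 1 N).
    by rewrite (eulerp_sqr 2) (eulerp_sqr 1); ring.
  exact: eqX_mul.
pose B1 : {poly 'F_2} := \poly_(i < n.+1) B`_(4 * i + 1).
(* Taking the exponents 4i + 1 in [sec] turns f_4 into f_1 and the right side into f_12 = f_3^3 f_3,
   where f_3^3 is f_1 [G]; f_1 then cancels. *)
have B1E : eqX n.+1 (eulerp 1 N * B1) (eulerp 1 N * (G * eulerp 3 N)).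
  apply: (eqX_trans (B := eulerp 12 N)); last first.
    have -> : eulerp 12 N = eulerp 3 N ^+ 3 * eulerp 3 N.
      by rewrite (eulerp_sqr 6) (eulerp_sqr 3); ring.
    rewrite mulrA; apply/eqX_sym; apply: eqX_mul => //.
    by apply: eqX_leq Gf; rewrite /N; lia.
  move=> i lt_in; have lt_iN : (4 * i + 1 < N.+1)%N by rewrite /N; lia.
  have := sec (4 * i + 1)%N lt_iN; rewrite (eulerp_comp 4) coef_comp_XnM // => E.
  transitivity ((eulerp 1 N ^+ 3 * eulerp 21 N)`_(4 * i + 1)).
    rewrite -E coefM -(big_mkord xpredT (fun j => (eulerp 1 N)`_j * B1`_(i - j))).
    by apply: eq_bigr => j _; rewrite coef_poly ltnS (leq_trans (leq_subr _ _)).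
  rewrite (@coef_theta_eulerp _ 8) //; last first.
    by move=> j le_j; rewrite eulerp1_cube_coef //; lia.
  by rewrite F2_natr_odd odd_size_theta_reps_21 eulerp_coef //; lia.
rewrite -BE //.
have := eqX_cancel f0 B1E (ltnSn n); rewrite coef_poly ltnSn => ->.
apply: coef_theta_eulerp => //; first by rewrite /N; lia.
by move=> i le_in; apply: GE; rewrite /N; lia.
Qed.

(** * Primes in Q *)

(** If t = 0, then p is s^2 or 2 s^2; if 3 divides s, then 3 divides p, which is at least 27. With s
    and t nonzero, p is at least 2 + 27. *)
Lemma form_nonzero (p : nat) (c e s t : int) : prime p -> odd p ->
  (c = 1 /\ e = 6) \/ (c = 2 /\ e = 3) ->
  p%:Z = c * s ^+ 2 + 9 * e * t ^+ 2 ->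
  [/\ t != 0, ~~ (3 %| s)%Z & (28 < p)%N].
Proof.
move=> pr podd ce pE.
have primeE (d : nat) : (d %| p)%N -> d = 1%N \/ d = p.
  by move=> dp; have /primeP[_ /(_ d dp)/orP[/eqP|/eqP]] := pr; [left | right].
have p1 := prime_gt1 pr.
have t0 : t != 0.
  apply/eqP => t0; rewrite t0 expr0n mulr0 addr0 in pE.
  case: ce pE => -[-> _] pE; last by clear - podd pE; lia.
  rewrite mul1r in pE.
  have pn : p = (absz s * absz s)%N by rewrite -[p]/(absz p%:Z) pE expr2 abszM.
  have sp : (absz s %| p)%N by rewrite pn dvdn_mulr.
  by case: (primeE _ sp) => sE; rewrite sE in pn; clear - pn p1; nia.
have t2 : 1 <= t ^+ 2 by rewrite -gtz0_ge1 exprn_even_gt0.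
have s2 := sqr_ge0 s.
have p27 : (26 < p)%N by case: ce pE => -[-> ->]; clear - s2 t2; lia.
have s3 : ~~ (3 %| s)%Z.
  apply/dvdzP => -[q sE].
  have : (3 %| p)%N.
    rewrite -[(_ %| _)%N]/(3 %| p%:Z)%Z; apply/dvdzP.
    by exists (3 * c * q ^+ 2 + 3 * e * t ^+ 2); rewrite pE sE; ring.
  by case/primeE => // p3'; lia.
split=> //; have s0 : s != 0 by apply: contraNneq s3 => ->.
have {}s2 : 1 <= s ^+ 2 by rewrite -gtz0_ge1 exprn_even_gt0.
by case: ce pE => -[-> ->]; clear - s2 t2; lia.
Qed.

(** Both shapes of [p] satisfy c e = 6, which lets one reflection, preserving 8 x^2 + 3 y^2, serve
    for both. *)
Lemma even_size_theta_reps_3 (p n : nat) (c e s t : int) :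
  prime p -> odd p -> (c = 1 /\ e = 6) \/ (c = 2 /\ e = 3) ->
  p%:Z = c * s ^+ 2 + 9 * e * t ^+ 2 ->
  (p %| 24 * n + 11)%N -> ~~ (p ^ 2 %| 24 * n + 11)%N ->
  ~~ odd (size (theta_reps 3 3 n)).
Proof.
move=> pr podd ce pE pN p2N; set r := theta_reps _ _ _.
have [t0 s3 p28] := form_nonzero pr podd ce pE.
have p_small (d : nat) : (0 < d <= 28)%N -> ~~ (p%:Z %| d%:Z)%Z.
  by move=> d28; rewrite dvdzE /= gtnNdvd //; lia.
have [M NE] : exists M : nat, (24 * n + 11 = p * M)%N.
  by have /dvdnP[M ->] := pN; exists M; rewrite mulnC.
have pM : ~~ (p %| M)%N.
  by apply: contra p2N => pM; rewrite NE -mulnn dvdn_pmul2l // prime_gt0.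
have p_mul (x y : int) : (p%:Z %| x * y)%Z -> (p%:Z %| x)%Z \/ (p%:Z %| y)%Z.
  by rewrite !dvdzE abszM Euclid_dvdM // => /orP.
have three_mul (x y : int) : (3 %| x * y)%Z -> (3 %| x)%Z \/ (3 %| y)%Z.
  by rewrite !dvdzE abszM Euclid_dvdM // => /orP.
have ps : ~~ (p%:Z %| s)%Z.
  apply/dvdzP => -[q sE].
  have s0 : s != 0 by apply: contraNneq s3 => ->.
  have q2 : 1 <= q ^+ 2.
    by rewrite -gtz0_ge1 exprn_even_gt0 //=; apply: contraNneq s0 => q0; rewrite sE q0 mul0r.
  have sp : s ^+ 2 <= p%:Z.
    have := sqr_ge0 s; have := sqr_ge0 t; rewrite pE.
    by clear - ce; case: ce => -[-> ->]; lia.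
  have : s ^+ 2 = q ^+ 2 * p%:Z * p%:Z by rewrite sE; ring.
  by clear - q2 sp p28; nia.
have memE x y : (absz x, absz y) \in r <->
    [/\ exists i, x ^+ 2 = 3 * i + 1, exists l, y ^+ 2 = 24 * l + 1
    & 8 * x ^+ 2 + 3 * y ^+ 2 = p%:Z * M%:Z].
  have {}NE : p%:Z * M%:Z = 24 * n%:Z + 11 by rewrite -PoszM -NE; lia.
  rewrite mem_theta_reps_int // NE.
  by split=> -[? ? E]; split=> //; clear - E; lia.
have memN (x y : nat) := memE x y.
rewrite (@odd_size_reflection (- (2 * e * t)) s p%:Z (9 * t) (- (2 * c * s)) r xpred0) //.
- by rewrite count_pred0.
- by apply/eqP; lia.
- by rewrite pE; ring.
- exact: theta_reps_uniq.
- move=> x y /memN[_ _ E].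
  set A := - (2 * e * t) * x%:Z + _; set B := - (2 * e * t) * x%:Z - _.
  (* Eliminating 8 x^2 = p M - 3 y^2 with c e = 6 leaves y^2 multiplied by c s^2 + 9 e t^2 = p. *)
  have AB : c * (A * B) = p%:Z * (3 * e * t ^+ 2 * M%:Z - y%:Z ^+ 2).
    have -> : p%:Z * (3 * e * t ^+ 2 * M%:Z - y%:Z ^+ 2)
      = 3 * e * t ^+ 2 * (p%:Z * M%:Z) - p%:Z * y%:Z ^+ 2 by ring.
    by rewrite -E pE /A /B; case: ce => -[-> ->]; ring.
  have pAB : (p%:Z %| A)%Z \/ (p%:Z %| B)%Z.
    apply: (p_mul); have /p_mul[|//] : (p%:Z %| c * (A * B))%Z by rewrite AB dvdz_mulr.
    have [->|->] : c = 1 \/ c = 2 by case: ce => -[-> _]; [left | right].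
      by rewrite (negbTE (p_small 1%N isT)).
    by rewrite (negbTE (p_small 2%N isT)).
  (* If p divides both, it divides y and then x, so p^2 divides p M, contrary to the exact
     divisibility. *)
  have nAB : ~ ((p%:Z %| A)%Z /\ (p%:Z %| B)%Z).
    move=> [pA pB]; have : (p%:Z %| 2 * (s * y%:Z))%Z.
      by rewrite (_ : 2 * _ = A - B); [exact: rpredB | rewrite /A /B; ring].
    case/p_mul; first by rewrite (negbTE (p_small 2%N isT)).
    case/p_mul; first by rewrite (negbTE ps).
    move=> /dvdzP[y1 yE]; have /p_mul[] : (p%:Z %| 8 * (x%:Z * x%:Z))%Z.
    - apply/dvdzP; exists (M%:Z - 3 * p%:Z * y1 ^+ 2).
      have -> : 8 * (x%:Z * x%:Z) = p%:Z * M%:Z - 3 * y%:Z ^+ 2 by rewrite -E; ring.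
      by rewrite yE; ring.
    - by rewrite (negbTE (p_small 8%N isT)).
    move=> pxx; have /dvdzP[x1 xE] : (p%:Z %| x%:Z)%Z by case: (p_mul _ _ pxx).
    move/negP: pM; apply; rewrite -[(_ %| _)%N]/(p%:Z %| M%:Z)%Z; apply/dvdzP.
    exists (8 * x1 ^+ 2 + 3 * y1 ^+ 2); apply: (@mulfI _ p%:Z); first by apply/eqP; lia.
    by rewrite -E xE yE; ring.
  by case: (boolP (p%:Z %| A)%Z) pAB nAB => pA; case: (boolP (p%:Z %| B)%Z) => pB //= [] // _ [].
move=> x y k /memE[[i xE] [l yE] E] kE; split.
  apply/memE; split.
  - exists (i + 6 * x * t * k + 27 * t ^+ 2 * k ^+ 2).
    have -> : (x + 9 * t * k) ^+ 2 = x ^+ 2 + 18 * x * t * k + 81 * t ^+ 2 * k ^+ 2 by ring.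
    by rewrite xE; ring.
  (* The square of y changes by 4 csk (csk - y). The product is even as y is odd, and 3 divides csk
     - y because it divides p (csk - y); so 24 divides the change. *)
  - have [b bE] := @odd_sqr_int y (12 * l) ltac:(clear - yE; lia).
    have [h hE] := even_mul_sub (c * s * k) bE.
    have [g gE] : exists g, c * s * k - y = 3 * g.
      have [g gE] : exists g, p%:Z * (c * s * k - y) = 3 * g.
        exists (- (4 * s * t * x) - 3 * e * t ^+ 2 * y).
        have -> : p%:Z * (c * s * k - y) = c * s * (p%:Z * k) - p%:Z * y by ring.
        by rewrite -kE pE; case: ce => -[-> ->]; ring.
      have : (3 %| p%:Z * (c * s * k - y))%Z by rewrite gE dvdz_mulr.
      case/three_mul => [|/dvdzP[g' ->]]; last by exists g'; ring.
      rewrite dvdzE /= => p3; have /primeP[_ /(_ 3 p3)] := pr.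
      by clear - p28; lia.
    exists (l + h - c * s * k * g).
    have -> : (y + - (2 * c * s) * k) ^+ 2 = y ^+ 2 + 4 * (c * s * k * (c * s * k - y)) by ring.
    have h3 : h = 3 * h - 3 * (c * s * k * g) by rewrite gE in hE; clear - hE; lia.
    by rewrite yE hE; clear - h3; lia.
  - rewrite -E; apply/eqP; rewrite -subr_eq0.
    rewrite (_ : _ - _ = 12 * c * k * (p%:Z * k - (- (2 * e * t) * x + s * y))).
      by rewrite kE subrr mulr0.
    by rewrite pE; case: ce => -[-> ->]; ring.
apply/negbTE/eqP => -[xE' _].
(* A fixed point has k = 0, which forces 3 to divide s y, or 2x = -9tk, which forces 3 to divide x;
   both contradict the residues of x, y and s. *)
have [tk0|xtk] : t * k = 0 \/ 2 * x = - 9 * (t * k) by clear - xE'; lia.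
  have {tk0} k0 : k = 0 by move/eqP: tk0; rewrite mulf_eq0 (negbTE t0) => /eqP.
  have /three_mul[] : (3 %| s * y)%Z.
  - rewrite k0 mulr0 in kE; apply/dvdzP.
    by case: ce kE => -[_ ->] kE; [exists (4 * t * x) | exists (2 * t * x)]; clear - kE; lia.
  - by rewrite (negbTE s3).
  by move=> /dvdzP[y1 y1E]; rewrite y1E in yE; clear - yE; lia.
have : 4 * x ^+ 2 = 81 * (t * k) ^+ 2.
  by rewrite (_ : 4 * x ^+ 2 = (2 * x) ^+ 2); [rewrite xtk; ring | ring].
by rewrite xE; clear; lia.
Qed.

(** For j = 4 parity forces y even, for j = 8 it forces y divisible by 4; dividing by j leaves 2 s^2
    + 27 t^2 or s^2 + 54 t^2. *)
Lemma inQ_form p : inQ p -> exists c e s t : int,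
  ((c = 1 /\ e = 6) \/ (c = 2 /\ e = 3)) /\ p%:Z = c * s ^+ 2 + 9 * e * t ^+ 2.
Proof.
move=> [pr podd [j [x [y [jE _ E]]]]].
have parity (z : int) : exists w, z = 2 * w \/ z = 2 * w + 1 by exists (z %/ 2)%Z; lia.
move: jE E; rewrite !inE => /or3P[]/eqP-> E; rewrite PoszM in E.
- by exists 2, 3, (2 * x), y; split; [right | lia].
- have [w [yE|yE]] := parity y; rewrite yE in E; last by lia.
  by exists 2, 3, x, w; split; [right | lia].
have [w [yE|yE]] := parity y; rewrite yE in E; last by lia.
have [v [wE|wE]] := parity w; rewrite wE in E; last by lia.
by exists 1, 6, x, v; split; [left | lia].
Qed.

Lemma prime_sqr_mod24 p : prime p -> (3 < p)%N -> (p ^ 2 == 1 %[mod 24])%N.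
Proof.
move=> pr p3; rewrite -modnXm.
have nd d : (1 < d < p)%N -> (d %| 24)%N -> ((p %% 24) %% d != 0)%N.
  move=> /andP[d1 dp] d24; rewrite modn_dvdm //; apply/negP => /eqP/eqP pd.
  by have /primeP[_ /(_ d pd)] := pr; lia.
have n3 := nd 3 p3 isT; have n2 := nd 2 (ltnW p3) isT.
have : (p %% 24 < 24)%N by rewrite ltn_mod.
move: (p %% 24)%N n2 n3 => r; by do 24! [case: r => [|r] //].
Qed.

(** With 24 u = p r + 1, p^2 divides 24 q + 11 only if 24 beta - 11 r = l' p. A congruence modulo 24
    and size bounds leave l' = 11, that is beta = 11 (p + r) / 24, the excluded value. *)
Lemma exact_dvd (p n : nat) (u beta : int) :
  prime p -> (28 < p)%N -> is_inv24 p u -> 0 <= beta < p%:Z ->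
  beta%:~R != excluded p u ->
  exists2 q : nat, p%:Z ^+ 2 * n%:Z + beta * p%:Z - 11%:Z * u = q%:Z
    & (p %| 24 * q + 11)%N && ~~ (p ^ 2 %| 24 * q + 11)%N.
Proof.
move=> pr p28 [uE /andP[u1 up]] /andP[b0 bp] nex.
have [q qE] : exists q : nat, p%:Z ^+ 2 * n%:Z + beta * p%:Z - 11%:Z * u = q%:Z.
  have : 0 <= p%:Z ^+ 2 * n%:Z + beta * p%:Z - 11%:Z * u.
    by rewrite !addr_ge0 ?mulr_ge0 ?exprn_ge0 //; lia.
  by case: (_ - _) => // q _; exists q.
exists q => //.
have [r rE] : exists r, 24 * u = p%:Z * r + 1.
  have /eqP := uE; rewrite eqz_mod_dvd => /dvdzP[r rE]; exists r; lia.
have nE : (24 * q + 11)%N%:Z = p%:Z * (24 * p%:Z * n%:Z + 24 * beta - 11 * r).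
  have -> : (24 * q + 11)%N%:Z = 24 * (p%:Z ^+ 2 * n%:Z + beta * p%:Z) - 11 * (24 * u) + 11.
    by clear - qE; lia.
  by rewrite rE; ring.
have p0 : p%:Z != 0 by apply/eqP; lia.
apply/andP; split.
  by rewrite -[(_ %| _)%N]/(p%:Z %| (24 * q + 11)%N%:Z)%Z nE dvdz_mulr.
apply/negP => p2.
have : (p%:Z * p%:Z %| p%:Z * (24 * p%:Z * n%:Z + 24 * beta - 11 * r))%Z.
  by rewrite -nE -PoszM mulnn.
rewrite dvdz_mul2l // => /dvdzP[l lE].
have [h hE] : exists h : int, p%:Z * p%:Z = 24 * h + 1.
  have /(@eq1_modP 24 _ isT)[h hE] := prime_sqr_mod24 pr (ltn_trans (isT : (3 < 28)%N) p28).
  by exists h%:Z; clear - hE; lia.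
have [l' l'E] : exists l', 24 * beta - 11 * r = l' * p%:Z.
  by exists (l - 24 * n%:Z); rewrite mulrBl -lE; ring.
(* Multiplying by p and using p^2 = 1 modulo 24 gives l' = -11 p r = 11 modulo 24. *)
have [z zE] : exists z, l' = 11 + 24 * z.
  exists (beta * p%:Z - 11 * u - h * l').
  have : l' * (p%:Z * p%:Z) = 24 * beta * p%:Z - 11 * (p%:Z * r) by rewrite mulrA -l'E; ring.
  by rewrite hE (_ : p%:Z * r = 24 * u - 1); clear - rE; lia.
have r0 : r < 0 by clear - rE u1 p28; nia.
have r24 : - 24 < r by clear - rE up p28; nia.
have l'0 : 0 < l' by clear - l'E r0 b0 p28; nia.
(* 35 = 11 + 24 is the next member of the class; l' p < 24 p + 11 * 24 stays below 35 p since p >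
   28. *)
have l'35 : l' < 35 by clear - l'E r24 bp p28; nia.
have l'11 : l' = 11 by clear - zE l'0 l'35; lia.
case/eqP: nex; rewrite /excluded.
have -> : 11%:Z * (p%:Z ^+ 2 + 24%:Z * u - 1) = beta * (24 * p)%N%:Z.
  have -> : beta * (24 * p)%N%:Z = p%:Z * (24 * beta) by rewrite PoszM; ring.
  have -> : 24 * beta = 11 * p%:Z + 11 * r by clear - l'E l'11; lia.
  by rewrite rE; ring.
by rewrite intrM -pmulrn mulfK // pnatr_eq0; clear - p28; lia.
Qed.

(* The argument of b_reg is a positive integer, since u < 0 <= beta; absz only
   converts it to nat. *)
Theorem theorem1p1 (p : nat) (u : int) (n : nat) (beta : int) :
  inQ p ->
  is_inv24 p u ->
  0 <= beta < p%:Z ->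
  beta%:~R != excluded p u ->
  (b_reg 21 `|(4%:Z * (p%:Z ^+ 2 * n%:Z + beta * p%:Z - 11%:Z * u) + 1)%R|
    = 0 %[mod 2])%N.
Proof.
move=> Qp up bp nex; have [pr podd _] := Qp.
have [c [e [s [t [ce pE]]]]] := inQ_form Qp.
have [_ _ p28] := form_nonzero pr podd ce pE.
have [q -> /andP[pq p2q]] := exact_dvd n pr p28 up bp nex.
rewrite (_ : absz _ = (4 * q + 1)%N) //.
have := b_reg21_theta q; rewrite F2_natr_odd [RHS]F2_natr_odd.
rewrite (negbTE (even_size_theta_reps_3 pr podd ce pE pq p2q)) modn2.
by case: odd.
Qed.
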